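(* Let $\mathcal{L}$ be a finite atomic lattice with set of atoms $S$, and let $\mathcal{B}$ be an $\mathcal{L}$-building set. Then the $\mathcal{L}$-nested complex of $\mathcal{B}$ is isomorphic to a subcomplex of the boolean nested complex of the boolean building set $\mathcal{B}'$ on $S$ obtained as the boolean building closure of $\{S_{\le B}:B\in\mathcal{B}\}$.
   Context: A lattice is atomic if every element is a join of atoms. For $X\in\mathcal{L}$, $S_{\le X}=\{s\in S:s\le X\}$. For a finite lattice $\mathcal{L}$ with bottom $\hat 0$, an $\mathcal{L}$-building set is a subset $\mathcal{B}\subseteq\mathcal{L}_{>\hat 0}$ such that for every $Y\in\mathcal{L}_{>\hat 0}$, with $\{B_1,\dots,B_k\}=\max(\mathcal{B}_{\le Y})$, there is a poset isomorphism $\prod_{j}\mathcal{L}_{\le B_j}\to\mathcal{L}_{\le Y}$ whose $j$-th component is the inclusion. Let $\kappa(\mathcal{B})=\max(\mathcal{B})$. An $\mathcal{L}$-nested set on $\mathcal{B}$ is a subset $\mathcal{N}\subseteq\mathcal{B}$ containing $\kappa(\mathcal{B})$ such that for any $k\ge2$ pairwise incomparable $B_1,\dots,B_k\in\mathcal{N}\setminus\kappa(\mathcal{B})$, the join $B_1\vee\cdots\vee B_k$ is not in $\mathcal{B}$. The $\mathcal{L}$-nested complex of $\mathcal{B}$ is the simplicial complex with faces $\mathcal{N}\setminus\kappa(\mathcal{B})$. A boolean building set on $S$ is a set $\mathcal{B}'$ of non-empty subsets of $S$ containing all singletons and such that $B,B'\in\mathcal{B}'$ with $B\cap B'\neq\varnothing$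 implies $B\cup B'\in\mathcal{B}'$. The boolean building closure of a collection of subsets of $S$ is the smallest boolean building set on $S$ containing it. A nested set on $\mathcal{B}'$ is a subset $\mathcal{N}\subseteq\mathcal{B}'$ containing the set $\kappa(\mathcal{B}')$ of inclusion-maximal elements of $\mathcal{B}'$, such that any two elements of $\mathcal{N}$ are nested or disjoint, and the union of any $k\ge2$ pairwise disjoint elements of $\mathcal{N}$ is not in $\mathcal{B}'$. The boolean nested complex of $\mathcal{B}'$ has faces $\mathcal{N}\setminus\kappa(\mathcal{B}')$. *)

(* Defs.v *)
From HB Require Import structures.
From mathcomp Require Import all_boot all_order.

Set Implicit Arguments.
Unset Strict Implicit.
Unset Printing Implicit Defensive.

Import Order.TTheory.
Local Open Scope order_scope.

Definition maximals (T : finType) (lt : rel T) (A : {set T}) : {set T} :=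
  [set x in A | [forall y in A, ~~ lt x y]].

Section SimplicialComplexes.

Implicit Types T U : finType.

(* An abstract simplicial complex is given by its set of faces, the empty face
   included; the vertices are the points covered by the faces, so that points
   of the ambient type lying in no face play no role. *)
Definition simplicial_complex T (K : {set {set T}}) : Prop :=
  set0 \in K /\ (forall F G : {set T}, F \in K -> G \subset F -> G \in K).

Definition subcomplex T (K' K : {set {set T}}) : Prop :=
  simplicial_complex K' /\ K' \subset K.

Definition complex_iso T U (K : {set {set T}}) (K' : {set {set U}}) : Prop :=
  exists f : T -> U,
    [/\ {in cover K &, injective f},
        f @: cover K = cover K'
      & forall F : {set T}, F \subset cover K -> (F \in K) = (f @: F \in K')].

End SimplicialComplexes.

Section LatticeNestedComplexes.

Variables (d : Order.disp_t) (L : finTBLatticeType d).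
Implicit Types (B N A : {set L}) (x y Y : L).

Definition atom x : bool := (x != \bot) && [forall y, (y < x) ==> (y == \bot)].

Definition atoms : {set L} := [set x | atom x].

(* The bottom element is the join of the empty set of atoms. *)
Definition atomic_lattice : Prop :=
  forall x, exists2 A : {set L}, A \subset atoms & x = \join_(a in A) a.

Definition atoms_below x : {set L} := [set a in atoms | a <= x].

Definition lower_interval y := {x : L | x <= y}.

Definition factors B Y : {set L} := maximals <%O [set b in B | b <= Y].

(* The product of the intervals [\bot, b] over the factors b of Y. *)
Definition factor_product B Y :=
  {dffun forall j : {b : L | b \in factors B Y}, lower_interval (val j)}.

Definition product_le B Y (p q : factor_product B Y) : Prop :=
  forall j, val (p j) <= val (q j).

(* The last clause says that phi restricts to the inclusion on the j-th factor,
   which sits in the product as the tuples equal to \bot off coordinate j. *)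
Definition factor_iso B Y (phi : factor_product B Y -> lower_interval Y) :
    Prop :=
  [/\ bijective phi,
      forall p q : factor_product B Y, val (phi p) <= val (phi q) <-> product_le p q
    & forall j (p : factor_product B Y), (forall i, i != j -> val (p i) = \bot) ->
        val (phi p) = val (p j)].

Definition lattice_building_set B : Prop :=
  \bot \notin B /\
  forall Y, Y != \bot ->
    exists phi : factor_product B Y -> lower_interval Y, factor_iso phi.

Definition lattice_kappa B : {set L} := maximals <%O B.

Definition lattice_nested_set B N : bool :=
  [&& N \subset B, lattice_kappa B \subset N &
    [forall A : {set L},
      [&& A \subset N :\: lattice_kappa B, (2 <= #|A|)%N &
          [forall x in A, forall y in A, (x != y) ==> (x >< y)]]
      ==> (\join_(x in A) x \notin B)]].

Definition lattice_nested_complex B : {set {set L}} :=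
  [set N :\: lattice_kappa B | N in lattice_nested_set B].

Lemma lattice_nested_complexP B : simplicial_complex (lattice_nested_complex B).
Proof.
have sub (F N : {set L}) : lattice_nested_set B N -> F \subset N :\: lattice_kappa B ->
    F \in lattice_nested_complex B.
  case/and3P=> NB kN /forallP nN FN.
  have FK : (F :|: lattice_kappa B) :\: lattice_kappa B = F.
    apply/setP => x; rewrite in_setD in_setU; case: (boolP (x \in F)) => [xF|_].
      by have := subsetP FN x xF; rewrite in_setD orTb andbT => /andP[].
    by case: (x \in lattice_kappa B).
  apply/imsetP; exists (F :|: lattice_kappa B); last by rewrite FK.
  apply/and3P; split; last 1 first.
  - rewrite FK; apply/forallP => A; apply/implyP => /and3P[AF A2 Ai].
    apply: (implyP (nN A)); rewrite A2 Ai !andbT.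
    exact: subset_trans AF FN.
  - rewrite subUset (subset_trans kN NB) andbT.
    by apply: subset_trans (subset_trans FN _) NB; apply: subsetDl.
  - exact: subsetUr.
split; last first.
  by move=> F G /imsetP[N nN ->] GN; apply: sub nN GN.
apply: (sub set0 (lattice_kappa B)); last exact: sub0set.
apply/and3P; split=> //.
  by apply/subsetP => x; rewrite inE => /andP[].
apply/forallP => A; apply/implyP => /and3P[].
by rewrite setDv subset0 => /eqP ->; rewrite cards0.
Qed.

End LatticeNestedComplexes.

Section BooleanNestedComplexes.

Variables (T : finType) (S : {set T}).
Implicit Types (B C N A : {set {set T}}) (X Y : {set T}).

Definition boolean_building_set B : bool :=
  [&& [forall X in B, (X != set0) && (X \subset S)],
      [forall s in S, [set s] \in B]
    & [forall X in B, forall Y in B,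
        (X :&: Y != set0) ==> (X :|: Y \in B)]].

(* By building_closureP below, this is the smallest boolean building set on S
   containing C as soon as C consists of nonempty subsets of S. *)
Definition building_closure C : {set {set T}} :=
  \bigcap_(B : {set {set T}} | boolean_building_set B && (C \subset B)) B.

Definition boolean_kappa B : {set {set T}} :=
  maximals (fun X Y => X \proper Y) B.

Definition boolean_nested_set B N : bool :=
  [&& N \subset B, boolean_kappa B \subset N,
    [forall X in N, forall Y in N,
      [|| X \subset Y, Y \subset X | [disjoint X & Y]]]
  & [forall A : {set {set T}},
      [&& A \subset N, (2 <= #|A|)%N & trivIset A] ==> (cover A \notin B)]].

Definition boolean_nested_complex B : {set {set {set T}}} :=
  [set N :\: boolean_kappa B | N in boolean_nested_set B].

Lemma building_closureP C :
  (forall X, X \in C -> X != set0 /\ X \subset S) ->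
  [/\ boolean_building_set (building_closure C), C \subset building_closure C
    & forall B, boolean_building_set B -> C \subset B ->
        building_closure C \subset B].
Proof.
move=> hC.
have leC B : boolean_building_set B -> C \subset B -> building_closure C \subset B.
  by move=> bB CB; apply: bigcap_inf; rewrite bB.
split=> //; last by apply/bigcapsP => B /andP[].
apply/and3P; split.
- pose P := [set X : {set T} | (X != set0) && (X \subset S)].
  have bP : boolean_building_set P.
    apply/and3P; split.
    + by apply/forall_inP => X; rewrite inE.
    + apply/forall_inP => s sS; rewrite inE sub1set sS andbT.
      by apply/set0Pn; exists s; rewrite inE.
    + apply/forall_inP => X; rewrite inE => /andP[/set0Pn[x xX] XS].
      apply/forall_inP => Y; rewrite inE => /andP[_ YS]; apply/implyP => _.
      rewrite inE subUset XS YS !andbT.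
      by apply/set0Pn; exists x; rewrite inE xX.
  have CP : C \subset P.
    by apply/subsetP => X /hC[X0 XS]; rewrite inE X0 XS.
  by apply/forall_inP => X /(subsetP (leC _ bP CP)); rewrite inE.
- apply/forall_inP => s sS; apply/bigcapP => B /andP[/and3P[_ hs _] _].
  exact: (forall_inP hs).
- apply/forall_inP => X hX; apply/forall_inP => Y hY; apply/implyP => XY.
  apply/bigcapP => B hB; have /andP[/and3P[_ _ hU] _] := hB.
  have XB := bigcapP hX B hB; have YB := bigcapP hY B hB.
  exact: (implyP (forall_inP (forall_inP hU X XB) Y YB) XY).
Qed.

End BooleanNestedComplexes.

(* Main.v *)
Require Import Defs.
From mathcomp Require Import all_boot all_order.

Set Implicit Arguments.
Unset Strict Implicit.
Unset Printing Implicit Defensive.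

Import Order.TTheory.
Local Open Scope order_scope.

(** The isomorphism is X |-> atoms_below X, which is injective, and reflects the
    order, because the lattice is atomic.

    The boolean closure B' adds many sets of atoms to the sets atoms_below X
    with X in B, but the join of every member of B' still lies in B
    (building_closure_join).  Indeed the nonempty sets of atoms with join in B
    form a boolean building set: for the union axiom, two elements of B with a
    nonzero meet have their join in B (building_join), since the product
    decomposition below that join forbids two distinct factors to share an
    element other than \bot; for the singletons, every atom lies in B
    (atom_building), since the interval below it cannot be an empty product.

    Hence an obstruction to nestedness in B' comes from one in B
    (nested_boolean_nested): at least two disjoint sets atoms_below X_i whose
    union lies in B' yield pairwise incomparable X_i with join in B, and so do
    two sets atoms_below X_i that cross, by building_join; a nested set
    excludes both.  The control of joins also shows that
    the maximal elements of B' are exactly the sets atoms_below X with X maximal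
    in B (boolean_kappa_building_closure), so that removing the maximal elements
    on both sides is compatible with the map.  The subcomplex is the image of
    the lattice nested complex. *)

(** * Maximal elements and images of complexes *)

(** Among the members above x, one with the most elements below it is maximal. *)
Lemma maximals_above (d : Order.disp_t) (L : finTBLatticeType d) (A : {set L})
    (x : L) :
  x \in A -> exists2 m, m \in maximals <%O A & x <= m.
Proof.
move=> xA; pose P y := (y \in A) && (x <= y).
have Px : P x by rewrite /P xA lexx.
case: (arg_maxnP (fun y => #|[set z | z <= y]|) Px) => m /andP[mA xm] mmax.
exists m => //; rewrite inE mA /=; apply/forall_inP => y yA; apply/negP => my.
have /mmax : P y by rewrite /P yA (le_trans xm (ltW my)).
rewrite /= leqNgt => /negP; apply; apply: proper_card; apply/properP; split.
  by apply/subsetP => z; rewrite !inE => /le_trans; apply; apply: ltW.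
by exists y; rewrite inE ?lexx // lt_geF.
Qed.

Lemma complex_iso_imset (T U : finType) (f : T -> U) (K : {set {set T}}) :
  injective f -> complex_iso K [set f @: F | F : {set T} in K].
Proof.
move=> f_inj; exists f; split.
- by move=> x y _ _; apply: f_inj.
- apply/setP => u; apply/imsetP/bigcupP.
    move=> [x /bigcupP[F FK xF] ->]; exists (f @: F); exact: imset_f.
  move=> [_ /imsetP[F FK ->] /imsetP[x xF ->]].
  by exists x => //; apply/bigcupP; exists F.
- by move=> F _; rewrite mem_imset //; apply: imset_inj.
Qed.

Lemma simplicial_complex_imset (T U : finType) (f : T -> U)
    (K : {set {set T}}) :
  simplicial_complex K -> simplicial_complex [set f @: F | F : {set T} in K].
Proof.
move=> [K0 Ksub]; split; first by apply/imsetP; exists set0; rewrite ?imset0.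
move=> _ G /imsetP[F FK ->] GF.
apply/imsetP; exists [set x in F | f x \in G].
  by apply: Ksub FK _; apply/subsetP => x; rewrite inE => /andP[].
apply/setP => u; apply/idP/imsetP => [uG|[x + ->]]; last first.
  by rewrite inE => /andP[].
have /imsetP[x xF ux] := subsetP GF u uG.
by exists x => //; rewrite inE xF -ux.
Qed.

(** * Atoms of an atomic lattice *)

Section Atoms.

Context (d : Order.disp_t) (L : finTBLatticeType d).
Hypothesis atomicL : atomic_lattice L.
Implicit Types (x y : L).

Lemma mem_atoms_below x y : (y \in atoms_below x) = (y \in atoms L) && (y <= x).
Proof. by rewrite inE. Qed.

Lemma atoms_below_sub x : atoms_below x \subset atoms L.
Proof. by apply/subsetP => a; rewrite mem_atoms_below => /andP[]. Qed.

Lemma join_atoms_below x : \join_(a in atoms_below x) a = x.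
Proof.
apply/le_anti/andP; split.
  by apply/joinsP => a; rewrite mem_atoms_below => /andP[].
have [A Aat xA] := atomicL x; rewrite {1}xA; apply/joinsP => a aA.
apply: joins_sup; rewrite mem_atoms_below (subsetP Aat) // xA.
exact: joins_sup.
Qed.

Lemma atoms_below_inj : injective (@atoms_below d L).
Proof. by move=> x y xy; rewrite -(join_atoms_below x) xy join_atoms_below. Qed.

Lemma sub_atoms_below (Z : {set L}) x :
  Z \subset atoms L ->
  (Z \subset atoms_below x) = (\join_(a in Z) a <= x).
Proof.
move=> Zat; apply/subsetP/joinsP => [Zx a /Zx|Zx a aZ].
  by rewrite mem_atoms_below => /andP[].
by rewrite mem_atoms_below (subsetP Zat) //= Zx.
Qed.

Lemma atoms_belowS x y : (atoms_below x \subset atoms_below y) = (x <= y).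
Proof. by rewrite sub_atoms_below ?atoms_below_sub // join_atoms_below. Qed.

Lemma atoms_below_proper x y :
  (atoms_below x \proper atoms_below y) = (x < y).
Proof. by rewrite properE !atoms_belowS lt_leAnge. Qed.

Lemma atoms_below_eq0 x : (atoms_below x == set0) = (x == \bot).
Proof.
have a0 : atoms_below (\bot : L) = set0.
  apply/setP => a; rewrite mem_atoms_below !inE lex0 andbC.
  by apply/negP => /andP[/eqP-> /andP[]]; rewrite eqxx.
by rewrite -a0 (inj_eq atoms_below_inj).
Qed.

Lemma atoms_below_disjoint x y :
  [disjoint atoms_below x & atoms_below y] = (x `&` y == \bot).
Proof.
rewrite -setI_eq0 -atoms_below_eq0; congr (_ == _); apply/setP => a.
by rewrite inE !mem_atoms_below lexI; case: (a \in atoms L).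
Qed.

Lemma join_cover_atoms_below (A : {set L}) :
  \join_(a in cover [set atoms_below x | x in A]) a = \join_(x in A) x.
Proof.
rewrite cover_imset; apply/le_anti/andP; split; apply/joinsP.
  move=> a /bigcupP[x xA]; rewrite mem_atoms_below => /andP[_ ax].
  by apply: le_trans ax _; apply: joins_sup.
move=> x xA; rewrite -{1}(join_atoms_below x); apply/joinsP => a ax.
by apply: joins_sup; apply/bigcupP; exists x.
Qed.

End Atoms.

(** * Lattice building sets *)

Section BuildingSet.

Context (d : Order.disp_t) (L : finTBLatticeType d) (B : {set L}).
Hypothesis buildingB : lattice_building_set B.
Implicit Types (x y Y : L).

Lemma building_neq0 x : x \in B -> x != \bot.
Proof. by case: buildingB => B0 _; apply: contraTneq => ->. Qed.

(** The tuple equal to x on one coordinate and to \bot elsewhere is sent to x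
    whichever coordinate is chosen; injectivity makes the two tuples equal. *)
Lemma factors_meet0 Y (b c x : L) :
  b \in factors B Y -> c \in factors B Y -> x <= b -> x <= c -> x != \bot ->
  b = c.
Proof.
move=> bF cF xb xc x0.
have Y0 : Y != \bot.
  apply: contraNneq x0 => Y0; rewrite -lex0 -Y0; apply: le_trans xb _.
  by move: bF; rewrite !inE => /andP[/andP[]].
have [phi [phi_bij _ phi_incl]] := buildingB.2 Y Y0.
pose bot (j : L) : lower_interval j := exist _ \bot (le0x j).
pose tup (i : {b : L | b \in factors B Y}) : factor_product B Y :=
  [ffun j => insubd (bot (val j)) (if j == i then x else \bot)].
have tupE i : x <= val i -> forall j, val (tup i j) = if j == i then x else \bot.
  by move=> xi j; rewrite ffunE val_insubd; case: eqP => [->|_];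
     rewrite ?xi ?le0x.
have phiE i : x <= val i -> val (phi (tup i)) = x.
  move=> xi; rewrite (phi_incl i) ?tupE ?eqxx // => j ji.
  by rewrite tupE // (negPf ji).
pose i : {b : L | b \in factors B Y} := Sub b bF.
pose j : {b : L | b \in factors B Y} := Sub c cF.
have tup_eq : tup i = tup j.
  by apply: (bij_inj phi_bij); apply: val_inj; rewrite !phiE.
apply/eqP; apply: contraNT x0 => bc.
have := tupE i xb i; rewrite tup_eq tupE // eqxx.
by rewrite -val_eqE /= (negPf bc) => ->.
Qed.

(** Both elements lie below factors of their join; a common element other than
    \bot forces these factors to be the same one, which is then the join. *)
Lemma building_join x y :
  x \in B -> y \in B -> x `&` y != \bot -> x `|` y \in B.
Proof.
move=> xB yB xy0; set Y := x `|` y.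
have memY z : z \in B -> z <= Y -> z \in [set b in B | b <= Y].
  by move=> zB zY; rewrite inE zB.
have [b bF xb] := maximals_above (memY x xB (leUl x y)).
have [c cF yc] := maximals_above (memY y yB (leUr y x)).
have bc : b = c.
  apply: (factors_meet0 bF cF _ _ xy0); first exact: le_trans (leIl _ _) xb.
  exact: le_trans (leIr _ _) yc.
move: bF; rewrite !inE => /andP[/andP[bB bY] _].
suff <- : b = Y by [].
by apply/le_anti; rewrite bY leUx xb bc yc.
Qed.

(** Otherwise the atom has no factor, and the interval below it, isomorphic to
    the empty product, would be a point. *)
Lemma atom_building x : x \in atoms L -> x \in B.
Proof.
rewrite inE => /andP[x0 /forallP x_min]; apply: contraNT (x0) => xB.
have [phi [[psi _ psiK] phi_le _]] := buildingB.2 x x0.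
have noF b : b \notin factors B x.
  apply/negP; rewrite !inE => /andP[/andP[bB bx] _].
  have := x_min b; rewrite (negPf (building_neq0 bB)) implybF.
  by rewrite lt_neqAle bx andbT negbK => /eqP bE; rewrite -bE bB in xB.
pose top : lower_interval x := exist _ x (lexx x).
pose bot : lower_interval x := exist _ \bot (le0x x).
have : val top <= val bot.
  rewrite -[top]psiK -[bot]psiK; apply/phi_le => -[b bF].
  by have := noF b; rewrite bF.
by rewrite lex0.
Qed.

End BuildingSet.

(** * The boolean closure of a lattice building set *)

Section Closure.

Context (d : Order.disp_t) (L : finTBLatticeType d) (B : {set L}).
Hypotheses (atomicL : atomic_lattice L) (buildingB : lattice_building_set B).

Let B' := building_closure (atoms L) [set atoms_below X | X in B].

Lemma atoms_below_closure x : x \in B -> atoms_below x \in B'.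
Proof.
move=> xB; apply/bigcapP => C /andP[_ /subsetP]; apply; exact: imset_f.
Qed.

(** B' is the smallest boolean building set containing the sets atoms_below x
    with x in B, so it suffices that the nonempty sets of atoms with join in B
    form one. *)
Lemma building_closure_join (Z : {set L}) :
  Z \in B' -> Z \subset atoms L /\ \join_(a in Z) a \in B.
Proof.
pose C := [set Z : {set L} | [&& Z != set0, Z \subset atoms L &
                                 \join_(a in Z) a \in B]].
suff B'C : B' \subset C.
  by move=> /(subsetP B'C); rewrite inE => /and3P[].
apply: (bigcap_inf C); apply/andP; split; last first.
  apply/subsetP => _ /imsetP[x xB ->].
  rewrite inE atoms_below_eq0 // (building_neq0 buildingB xB).
  by rewrite atoms_below_sub join_atoms_below.
apply/and3P; split.
- by apply/forall_inP => X; rewrite inE => /and3P[-> ->].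
- apply/forall_inP => s sS; rewrite inE sub1set sS big_set1.
  by rewrite atom_building // !andbT; apply/set0Pn; exists s; rewrite inE.
- apply/forall_inP => X; rewrite inE => /and3P[X0 XS XB].
  apply/forall_inP => Y; rewrite inE => /and3P[_ YS YB].
  apply/implyP => XY; rewrite inE setU_eq0 (negPf X0) subUset XS YS joins_setU.
  apply: building_join => //; apply: contraNneq XY => /eqP.
  rewrite -atoms_below_disjoint // setI_eq0.
  by apply: disjointW; rewrite sub_atoms_below.
Qed.

(** A set Z of the closure is contained in atoms_below of its join, which is
    itself in the closure: a maximal Z is therefore of this form. *)
Lemma boolean_kappa_building_closure :
  boolean_kappa B' = [set atoms_below X | X in lattice_kappa B].
Proof.
apply/setP => Z; apply/idP/imsetP.
  rewrite inE => /andP[ZB' /forall_inP Zmax].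
  have [ZS JB] := building_closure_join ZB'; set J := \join_(a in Z) a in JB.
  have ZJ : Z = atoms_below J.
    have := Zmax _ (atoms_below_closure JB).
    by rewrite properEneq sub_atoms_below // lexx andbT negbK => /eqP.
  exists J => //; rewrite inE JB; apply/forall_inP => y yB.
  by rewrite -atoms_below_proper // -ZJ Zmax // atoms_below_closure.
move=> [x + ->]; rewrite !inE => /andP[xB /forall_inP xmax].
rewrite atoms_below_closure //; apply/forall_inP => Y YB'.
have [YS JB] := building_closure_join YB'.
apply/negP => xY.
have YJ : Y \subset atoms_below (\join_(a in Y) a) by rewrite sub_atoms_below.
have := xmax _ JB.
by rewrite -atoms_below_proper // (proper_sub_trans xY YJ).
Qed.

Lemma nested_boolean_nested (N : {set L}) :
  lattice_nested_set B N ->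
  boolean_nested_set B' [set atoms_below X | X in N].
Proof.
case/and3P=> /subsetP NB kN /forallP nestN.
(* An element of N strictly below an element of B is not maximal in B, so the
   condition on antichains, which concerns non-maximal elements only, extends
   to all of N. *)
have joinN (A : {set L}) : A \subset N -> (2 <= #|A|)%N ->
    (forall x y, x \in A -> y \in A -> x != y -> x >< y) ->
    \join_(x in A) x \notin B.
  move=> AN A2 Ainc; apply/negP => JB.
  suff Ak : A \subset N :\: lattice_kappa B.
    have := nestN A; rewrite Ak A2 JB implybF /= => /negP; apply.
    apply/forall_inP => x xA; apply/forall_inP => y yA.
    by apply/implyP; apply: Ainc.
  apply/subsetP => x xA; rewrite inE (subsetP AN) // andbT.
  apply/negP; rewrite inE => /andP[_ /forall_inP/(_ _ JB)].
  rewrite lt_neqAle joins_sup // andbT negbK => /eqP xJ.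
  have /card_gt0P[y] : (0 < #|A :\ x|)%N.
    by move: A2; rewrite (cardsD1 x) xA.
  rewrite !inE => /andP[yx yA].
  by have := Ainc y x yA xA yx; rewrite /Order.comparable {1}xJ joins_sup.
apply/and4P; split.
- by apply/subsetP => _ /imsetP[x /NB xB ->]; apply: atoms_below_closure.
- by rewrite boolean_kappa_building_closure imsetS.
- apply/forall_inP => _ /imsetP[x xN ->].
  apply/forall_inP => _ /imsetP[y yN ->]; rewrite !atoms_belowS //.
  have [//|nxy] := boolP (x <= y); have [//|nyx] := boolP (y <= x).
  have xy : x != y by apply: contraNneq nxy => ->.
  have : \join_(z in [set x; y]) z \notin B.
    apply: joinN; rewrite ?cards2 ?xy //; first by rewrite subUset !sub1set xN.
    move=> u v; rewrite !inE /Order.comparable => /orP[]/eqP-> /orP[]/eqP->;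
      by rewrite ?eqxx ?(negPf nxy) ?(negPf nyx).
  rewrite joins_setU !big_set1 orFb orFb atoms_below_disjoint //.
  by apply: contraR; apply: building_join; rewrite ?NB.
- apply/forallP => A; apply/implyP => /and3P[AN A2 /trivIsetP Atriv].
  pose A0 := [set x in N | atoms_below x \in A].
  have AE : A = [set atoms_below x | x in A0].
    apply/setP => Z; apply/idP/imsetP => [ZA|[x + ->]]; last first.
      by rewrite inE => /andP[].
    have /imsetP[x xN Zx] := subsetP AN Z ZA.
    by exists x => //; rewrite inE xN -Zx.
  apply/negP => /building_closure_join[_].
  rewrite AE join_cover_atoms_below //; apply/negP/joinN.
  - by apply/subsetP => x; rewrite inE => /andP[].
  - by rewrite -(card_imset A0 (atoms_below_inj atomicL)) -AE.
  - move=> x y; rewrite !inE => /andP[xN xA] /andP[yN yA] xy.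
    have := Atriv _ _ xA yA; rewrite (inj_eq (atoms_below_inj atomicL)) xy.
    rewrite atoms_below_disjoint // => /(_ isT) meet0.
    apply/negP => /orP[] le_xy; move: meet0.
      by rewrite (meet_idPl le_xy) (negPf (building_neq0 buildingB (NB x xN))).
    by rewrite (meet_idPr le_xy) (negPf (building_neq0 buildingB (NB y yN))).
Qed.

End Closure.

Theorem corollary13p4 (d : Order.disp_t) (L : finTBLatticeType d) (B : {set L})
    (atomicL : atomic_lattice L) (buildingB : lattice_building_set B) :
  exists2 K : {set {set {set L}}},
    subcomplex K
      (boolean_nested_complex
         (building_closure (atoms L) [set atoms_below X | X in B])) &
    complex_iso (lattice_nested_complex B) K.
Proof.
have ab_inj := atoms_below_inj atomicL.
exists [set [set atoms_below X | X in F] | F : {set L} in lattice_nested_complex B].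
  split; first exact/simplicial_complex_imset/lattice_nested_complexP.
  apply/subsetP => _ /imsetP[_ /imsetP[N nestN ->] ->].
  apply/imsetP; exists [set atoms_below X | X in N].
    exact: nested_boolean_nested.
  rewrite boolean_kappa_building_closure //.
  apply/setP => Z; rewrite in_setD; apply/imsetP/andP => [[x + ->]|].
    by rewrite in_setD !mem_imset // => /andP.
  move=> [+ /imsetP[x xN ZE]]; rewrite ZE mem_imset // => xk.
  by exists x => //; rewrite in_setD xk.
exact: complex_iso_imset.
Qed.
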